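(* Consider a finite irreducible Markov renewal process with state space $S=\{1,\dots,m\}$, embedded (jump) chain transition matrix $P$ with stationary probability vector $\pi$, mean sojourn time vector $\mu$, $\lambda=\pi^T\mu>0$, and mean first passage times $m_{ij}$. Let $k^{\circ(3)}=(k^{\circ(3)}_1,\dots,k^{\circ(3)}_m)^T$ with $k_i^{\circ(3)}=\sum_{j=1,\,j\neq i}^m m_{ij}/m_{jj}$. Then: (a) If $G$ is any g-inverse of $I-P$, then $$k^{\circ(3)}=\tfrac1\lambda\{G\mu-\mathrm{tr}(G\mu\pi^T)e\}-Ge+\mathrm{tr}(G)e.$$ (b) If $Z=[I-P+\Pi]^{-1}$, then $$k^{\circ(3)}=\tfrac1\lambda\{Z\mu-\mathrm{tr}(Z\mu\pi^T)e\}+\mathrm{tr}(Z)e-e.$$ (c) If $A^{\#}$ is the group inverse of $I-P$, then $$k^{\circ(3)}=\tfrac1\lambda\{A^{\#}\mu-\mathrm{tr}(A^{\#}\mu\pi^T)e\}+\mathrm{tr}(A^{\#})e.$$ (d) If $\widetilde G=[I-P+\mu u^T]^{-1}$, where $u\in\mathbb{R}^m$ satisfies $u^Te\neq0$, then $$k^{\circ(3)}=\left[\mathrm{tr}(\widetilde G)I-\widetilde G\right]e.$$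
   Context: A Markov renewal process (MRP) $\{(X_n,T_n),n\ge 0\}$ on $S=\{1,\dots,m\}$ has $T_0=0\le T_1\le T_2\le\cdots$ and semi-Markov kernel $Q_{ij}(t)=P\{X_{n+1}=j,\ T_{n+1}-T_n\le t\mid X_n=i\}$ (Markov property: conditionally on the past up to step $n$, the law of $(X_{n+1},T_{n+1}-T_n)$ depends only on $X_n$, through this kernel). The embedded Markov chain $\{X_n\}$ has transition matrix $P=[p_{ij}]$, $p_{ij}=Q_{ij}(+\infty)$; the MRP is called irreducible when $P$ is irreducible. Put $\mu_{ij}=\int_0^\infty t\,dQ_{ij}(t)$, assumed finite, and $\mu_i=\sum_k\mu_{ik}$, the mean sojourn time on a visit to state $i$; $\mu=(\mu_1,\dots,\mu_m)^T$. $\pi=(\pi_1,\dots,\pi_m)^T$ is the unique vector with $\pi^TP=\pi^T$, $\pi^Te=1$, where $e=(1,\dots,1)^T$; $\Pi=e\pi^T$. $\lambda=\pi^T\mu$, assumed positive. The mean first passage time is $m_{ij}=E[T_{ij}\mid X_0=i]$, where $T_{ij}=T_n$ with $n=\min\{r\ge1: X_r=j\}$ given $X_0=i$ (the return time if $i=j$); these are all finite. A g-inverse (one-condition generalized inverse) of $I-P$ is any matrix $G$ with $(I-P)G(I-P)=I-P$. The group inverse $A^{\#}$ of $A=I-P$ is the unique matrix with $AA^{\#}A=A$, $A^{\#}AA^{\#}=A^{\#}$, $AA^{\#}=A^{\#}A$; it equals $Z-\Pi$. *)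

(* Defs.v *)
From HB Require Import structures.
From mathcomp Require Import all_boot all_order all_algebra.
From mathcomp Require Import all_classical all_reals all_analysis.

Set Implicit Arguments.
Unset Strict Implicit.
Unset Printing Implicit Defensive.

Import Order.TTheory GRing.Theory Num.Theory.
Import numFieldNormedType.Exports.

Local Open Scope classical_set_scope.
Local Open Scope ring_scope.

Section MarkovRenewalProcess.
Context {R : realType} {m : nat} {d : measure_display} {Om : measurableType d}.
Implicit Types (Q : 'I_m -> 'I_m -> cumulative R R).
Implicit Types (X : nat -> Om -> 'I_m) (T : nat -> Om -> R).

(* The sigma-algebra generated by X_0, T_0, ..., X_n, T_n. *)
Definition past X T (n : nat) : set (set Om) :=
  <<s [set A | exists2 r, (r <= n)%N &
         (exists k : 'I_m, A = X r @^-1` [set k]) \/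
         (exists2 B : set R, measurable B & A = T r @^-1` B)] >>.

(* T_0 = 0 <= T_1 <= ... holds on every path, not only almost surely.
   [mrp_markov] is the integrated form, over the events A of the past, of
   P(X_{n+1} = j, T_{n+1} - T_n <= t | past) = Q_{X_n, j}(t). *)
Record is_MRP (mu : probability Om R) Q X T : Prop := {
  mrp_measurableX : forall n (k : 'I_m), measurable (X n @^-1` [set k]) ;
  mrp_measurableT : forall n, measurable_fun [set: Om] (T n) ;
  mrp_T0 : forall w, T 0%N w = 0 ;
  mrp_T_nondecreasing : forall n w, T n w <= T n.+1 w ;
  mrp_markov : forall (n : nat) (A : set Om) (i j : 'I_m) (t : R),
    past X T n A ->
    (mu (A `&` [set w | X n w = i]
           `&` [set w | X n.+1 w = j /\ (T n.+1 w - T n w <= t)%R])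
     = mu (A `&` [set w | X n w = i]) * (Q i j t)%:E)%E
}.

Definition transition_matrix Q : 'M[R]_m :=
  \matrix_(i, j) lim (Q i j t @[t --> +oo%R]).

Definition kernel_mean Q (i j : 'I_m) : \bar R :=
  (\int[lebesgue_stieltjes_measure (Q i j)]_(t in `[0%R, +oo[) t%:E)%E.

Definition mean_sojourn Q : 'cV[R]_m :=
  \col_i \sum_(k < m) fine (kernel_mean Q i k).

(* T_n with n = min {r >= 1 : X_r = j}, and +oo on the paths that never enter j
   after time 0. *)
Definition first_passage_time X T (j : 'I_m) (w : Om) : \bar R :=
  match pselect (exists r : nat, (0 < r)%N && (X r w == j)) with
  | left h => (T (ex_minn h) w)%:E
  | right _ => +oo%E
  end.

(* [Pr i] is the law of the process given X_0 = i.  The expectation is finite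
   for an irreducible process with finite kernel means, so [fine] is only the
   cast to R. *)
Definition mean_first_passage (Pr : 'I_m -> probability Om R) X T : 'M[R]_m :=
  \matrix_(i, j) fine (\int[Pr i]_w first_passage_time X T j w)%E.

End MarkovRenewalProcess.

Section Matrices.
Context {R : realType} {m : nat}.
Implicit Types (P A G : 'M[R]_m) (p : 'cV[R]_m).

Definition irreducible_mx P : Prop :=
  forall i j : 'I_m, exists n : nat, 0 < (P ^+ n) i j.

Definition is_stationary P p : Prop :=
  p^T *m P = p^T /\ p^T *m (const_mx 1 : 'cV[R]_m) = 1%:M.

Definition is_ginverse A G : Prop := A *m G *m A = A.

Definition is_group_inverse A G : Prop :=
  [/\ A *m G *m A = A, G *m A *m G = G & A *m G = G *m A].

Definition k_circ3 (M : 'M[R]_m) : 'cV[R]_m :=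
  \col_i \sum_(j < m | j != i) M i j / M j j.

End Matrices.

(* Main.v *)
Require Import Defs.
From HB Require Import structures.
From mathcomp Require Import all_boot all_order all_algebra.
From mathcomp Require Import all_classical all_reals all_analysis.
From mathcomp Require Import measurable_realfun.

(* Let N_j be the transition matrix P with column j set to 0.  The passage time
   to j is the sum over n of (T_{n+1} - T_n) 1{X_1, ..., X_n <> j}, and the n-th
   term has mean (N_j^n mu)_i under X_0 = i.  As P is irreducible, I - N_j is
   invertible, so these sums converge to a solution of
   m_ij = mu_i + \sum_{k <> j} p_ik m_kj.
   Multiplying by pi gives pi_j m_jj = lambda, and then W = [m_ij / m_jj] - I
   satisfies (I - P) W = mu pi^T / lambda - I.  Since I - P has kernel spanned by
   e, W is G (mu pi^T / lambda - I) up to a constant on each column, which is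
   fixed by the zero diagonal of W; finally k3 = W e.  In (b) and (d) the inverse
   of I - P + a b^T is a g-inverse mapping a to e / (b^T e). *)

Set Implicit Arguments.
Unset Strict Implicit.
Unset Printing Implicit Defensive.

Import Order.TTheory GRing.Theory Num.Theory.
Import numFieldNormedType.Exports.

Local Open Scope classical_set_scope.
Local Open Scope ring_scope.

(** * Irreducible stochastic matrices *)

Section StochasticMatrices.
Context {R : realType} {m : nat}.
Local Notation e := (const_mx 1 : 'cV[R]_m).

Definition stochastic_mx (P : 'M[R]_m) : Prop :=
  (forall i j, 0 <= P i j) /\ P *m e = e.

(** Transposition turns the row-vector criterion [inj_row_free] into one for columns. *)
Lemma unitmx_injective (A : 'M[R]_m) :
  (forall x : 'cV[R]_m, A *m x = 0 -> x = 0) -> A \in unitmx.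
Proof.
move=> injA; rewrite -unitmx_tr -row_free_unit; apply: inj_row_free => v vA.
apply: trmx_inj; rewrite trmx0; apply: injA.
by rewrite -[A]trmxK -trmx_mul vA trmx0.
Qed.

Lemma row_sumE (A : 'M[R]_m) i : (A *m e) i 0 = \sum_j A i j.
Proof. by rewrite mxE; apply: eq_bigr => j _; rewrite mxE mulr1. Qed.

Lemma mulmx_mono (A : 'M[R]_m) (x y : 'cV[R]_m) :
  (forall i j, 0 <= A i j) -> (forall i, x i 0 <= y i 0) ->
  forall i, (A *m x) i 0 <= (A *m y) i 0.
Proof. by move=> A0 xy i; rewrite !mxE; apply: ler_sum => j _; apply: ler_wpM2l. Qed.

Lemma exprmx_ge0 (A : 'M[R]_m) n :
  (forall i j, 0 <= A i j) -> forall i j, 0 <= (A ^+ n) i j.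
Proof.
move=> A0; elim: n => [|n IH] i j; first by rewrite expr0 mxE ler0n.
by rewrite exprS mxE sumr_ge0// => k _; rewrite mulr_ge0.
Qed.

Lemma stochastic_exprmx (P : 'M[R]_m) n : stochastic_mx P -> stochastic_mx (P ^+ n).
Proof.
move=> [P0 P1]; split; first exact: exprmx_ge0.
elim: n => [|n IH]; first by rewrite expr0 mul1mx.
by rewrite exprS -mulmxE -mulmxA IH P1.
Qed.

(** Maximum principle: at an index [i] where [x] is largest, [x i] is at most [(P^n x) i], a
    weighted mean of values that do not exceed [x i]. Terms of positive weight therefore equal
    [x i], and irreducibility gives each [j] a positive weight for some [n]. *)
Lemma subharmonic_const (P : 'M[R]_m) (x : 'cV[R]_m) :
  stochastic_mx P -> irreducible_mx P ->
  (forall i, x i 0 <= (P *m x) i 0) -> exists c, x = c *: e.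
Proof.
move=> stP irrP xP.
case: (posnP m) => [m0|m0].
  by exists 0; apply/matrixP => i; exfalso; case: i => i; rewrite m0.
pose i0 := Ordinal m0; pose i := [arg max_(k > i0) x k 0]%O.
have ximax k : x k 0 <= x i 0 by rewrite /i; case: arg_maxP => // l _; apply.
have xPn n l : x l 0 <= (P ^+ n *m x) l 0.
  elim: n l => [|n IH] l; first by rewrite expr0 mul1mx.
  rewrite exprS -mulmxE -mulmxA; apply: le_trans (xP l) _.
  by apply: mulmx_mono; [exact: stP.1|].
exists (x i 0); apply/matrixP => j z; rewrite !ord1 !mxE mulr1.
have [n Pn] := irrP i j.
have [Pn0 Pn1] := stochastic_exprmx n stP.
have Pn1i : \sum_k (P ^+ n) i k = 1.
  by rewrite -row_sumE Pn1 mxE.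
have terms_ge0 k : 0 <= (P ^+ n) i k * (x i 0 - x k 0).
  by rewrite mulr_ge0// subr_ge0.
have : \sum_k (P ^+ n) i k * (x i 0 - x k 0) <= 0.
  under eq_bigr do rewrite mulrBr.
  rewrite sumrB -mulr_suml Pn1i mul1r subr_le0.
  by have := xPn n i; rewrite mxE.
rewrite le_eqVlt ltNge sumr_ge0//= orbF psumr_eq0// => /allP /(_ j).
rewrite mem_index_enum => /(_ isT); rewrite mulf_eq0 gt_eqF//= subr_eq0.
by move/eqP.
Qed.

(** Its power [n] holds the probabilities of an [n]-step move with no visit to [j] at times 1 to
    [n]; see [avoid_law]. *)
Definition taboo_mx (P : 'M[R]_m) (j : 'I_m) : 'M[R]_m :=
  \matrix_(i, k) (P i k *+ (k != j)).

Lemma taboo_mx_ge0 P j : stochastic_mx P -> forall i k, 0 <= taboo_mx P j i k.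
Proof. by move=> [P0 _] i k; rewrite mxE mulrn_wge0. Qed.

Lemma mulmx_taboo P j (x : 'cV[R]_m) i :
  (taboo_mx P j *m x) i 0 = (P *m x) i 0 - P i j * x j 0.
Proof.
rewrite !mxE (bigD1 j)//= mxE eqxx mulr0n mul0r add0r.
rewrite [X in _ = X - _](bigD1 j)//= addrAC subrr add0r.
by apply: eq_bigr => k kj; rewrite mxE kj.
Qed.

(** A zero column [j] stays zero in all positive powers, so no other state leads to [j]; if there is
    no other state, row [j] would sum to 0 instead of 1. *)
Lemma irreducible_col_neq0 P j : stochastic_mx P -> irreducible_mx P ->
  ~ (forall i, P i j = 0).
Proof.
move=> [P0 P1] irrP Pj0.
have Pnj n i : (P ^+ n.+1) i j = 0.
  by rewrite exprSr mxE big1// => k _; rewrite Pj0 mulr0.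
case: (pickP (fun i => i != j)) => [i ij|allj].
  have [[|n]] := irrP i j; last by rewrite Pnj ltxx.
  by rewrite expr0 mxE (negbTE ij) ltxx.
move/matrixP: P1 => /(_ j 0); rewrite !mxE big1 => [/eqP|k _].
  by rewrite eq_sym oner_eq0.
by have := allj k => /negbFE/eqP ->; rewrite Pj0 mul0r.
Qed.

(* |x| is subharmonic for P when x is fixed by the taboo matrix, hence constant;
   the mass lost through column j then forces the constant to be 0. *)
Lemma taboo_unitmx P j : stochastic_mx P -> irreducible_mx P ->
  1%:M - taboo_mx P j \in unitmx.
Proof.
move=> stP irrP; apply: unitmx_injective => x.
rewrite mulmxBl mul1mx => /subr0_eq xN.
have [P0 P1] := stP.
pose y : 'cV[R]_m := \col_i `|x i 0|.
have yN i : y i 0 <= (taboo_mx P j *m y) i 0.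
  rewrite !mxE {1}xN mxE (le_trans (ler_norm_sum _ _ _))//.
  apply: ler_sum => k _; rewrite normrM ger0_norm; last exact: taboo_mx_ge0.
  by rewrite !mxE.
have [|c yc] := subharmonic_const (x := y) stP irrP.
  move=> i; apply: le_trans (yN i) _.
  by rewrite mulmx_taboo lerBlDr lerDl mulr_ge0// mxE.
have {yN} cP i : c * P i j <= 0.
  have := yN i; rewrite mulmx_taboo yc -scalemxAr P1 !mxE mulr1.
  by rewrite lerBrDr -lerBrDl subrr mulrC.
have c0 : c = 0.
  apply/eqP/negP => /negP c0; apply: (irreducible_col_neq0 (j := j) stP irrP) => i.
  have c_gt0 : 0 < c.
    rewrite lt_def c0/=; have := normr_ge0 (x i 0).
    by move/matrixP: yc => /(_ i 0); rewrite !mxE mulr1 => ->.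
  by have := cP i; rewrite pmulr_rle0// => Pij; apply/eqP; rewrite eq_le Pij P0.
apply/matrixP => i k; rewrite ord1 mxE; apply/eqP; rewrite -normr_eq0.
by move/matrixP: yc => /(_ i 0); rewrite !mxE c0 mul0r => ->.
Qed.

(** The partial sums telescope to [w - N^K w] with [w = (I - N)^-1 b]. They are bounded because
    [N^K] is substochastic and nondecreasing because [b >= 0], hence they converge. *)
Lemma taboo_series P j (b : 'cV[R]_m) : stochastic_mx P -> irreducible_mx P ->
  (forall i, 0 <= b i 0) ->
  exists2 v : 'cV[R]_m, v = b + taboo_mx P j *m v &
    forall i, series (fun n => (taboo_mx P j ^+ n *m b) i 0) n @[n --> \oo] --> v i 0.
Proof.
move=> stP irrP b0; set N := taboo_mx P j.
have N0 n i k : 0 <= (N ^+ n) i k.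
  by apply: exprmx_ge0 => *; exact: taboo_mx_ge0.
pose S K : 'cV[R]_m := \sum_(0 <= n < K) N ^+ n *m b.
have SE K i : series (fun n => (N ^+ n *m b) i 0) K = S K i 0.
  by rewrite /S /series/= summxE.
pose w : 'cV[R]_m := invmx (1%:M - N) *m b.
have wN : w - N *m w = b.
  by rewrite -{1}[w]mul1mx -mulmxBl mulmxA mulmxV ?mul1mx// taboo_unitmx.
have Sw K : S K = w - N ^+ K *m w.
  elim: K => [|K IH]; first by rewrite /S big_geq// expr0 mul1mx subrr.
  rewrite /S big_nat_recr//= -/(S K) IH -wN mulmxBr addrA subrK.
  by rewrite mulmxA mulmxE exprSr.
pose C := \sum_i `|w i 0|.
have wC k : `|w k 0| <= C by rewrite /C (bigD1 k)//= lerDl sumr_ge0.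
have Ne n i : (N ^+ n *m e) i 0 <= 1.
  elim: n i => [|n IH] i; first by rewrite expr0 mul1mx mxE.
  rewrite exprS -mulmxE -mulmxA.
  apply: (@le_trans _ _ ((N *m e) i 0)).
    by apply: mulmx_mono => [*|k]; [exact: taboo_mx_ge0|rewrite [leRHS]mxE].
  rewrite mulmx_taboo stP.2 !mxE mulr1 gerBl; exact: stP.1.
have NwC n i : `|(N ^+ n *m w) i 0| <= C.
  rewrite mxE (le_trans (ler_norm_sum _ _ _))//.
  apply: (@le_trans _ _ (\sum_k (N ^+ n) i k * C)).
    by apply: ler_sum => k _; rewrite normrM ger0_norm// ler_wpM2l.
  rewrite -mulr_suml ler_piMl//; first by rewrite sumr_ge0.
  by rewrite -row_sumE.
have Scvg i : cvgn (fun K => S K i 0).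
  apply: nondecreasing_is_cvgn.
    apply/nondecreasing_seqP => K; rewrite /S big_nat_recr//= [leRHS]mxE.
    by rewrite lerDl mxE sumr_ge0// => k _; rewrite mulr_ge0.
  exists (C + C) => _ [K _ <-]; rewrite Sw mxE [X in _ + X]mxE.
  apply: lerD; first exact: le_trans (ler_norm _) (wC i).
  by rewrite (le_trans (ler_norm _))// normrN.
pose v : 'cV[R]_m := \col_i limn (fun K => S K i 0).
have Sv i : S K i 0 @[K --> \oo] --> v i 0 by rewrite mxE; exact: Scvg.
exists v => [|i]; last by have := Sv i; under eq_fun do rewrite -SE.
apply/matrixP => i k; rewrite ord1 {k}.
(* The fixed-point equation is the limit of [S (K+1) = b + N (S K)]. *)
have : S K.+1 i 0 @[K --> \oo] --> (b + N *m v) i 0.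
  have -> : (fun K => S K.+1 i 0) = (fun K => b i 0 + \sum_l N i l * S K l 0).
    apply/funext => K; rewrite /S big_nat_recl// expr0 mul1mx mxE; congr (_ + _).
    under eq_bigr do rewrite exprS -mulmxE -mulmxA.
    by rewrite -mulmx_sumr mxE.
  rewrite mxE [X in _ + X]mxE; apply: cvgD; first exact: cvg_cst.
  apply: cvg_big => [|l _]; first exact: add_continuous.
  by apply: cvgM; [exact: cvg_cst|exact: Sv].
have := Sv i; rewrite -cvg_shiftS => SvS SbN.
exact: (cvg_unique _ SvS SbN).
Qed.

End StochasticMatrices.

(** * Solving the first passage equations *)

Section FirstPassageEquations.
Context {R : realType} {m : nat}.
Local Notation e := (const_mx 1 : 'cV[R]_m).
Variables (P : 'M[R]_m) (p mu : 'cV[R]_m) (M : 'M[R]_m).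
Hypotheses (stP : stochastic_mx P) (irrP : irreducible_mx P).
Hypothesis hp : is_stationary P p.
Local Notation lambda := ((p^T *m mu) 0 0).
Hypothesis lambda_gt0 : 0 < lambda.
Hypothesis hM : forall i j, M i j = mu i 0 + \sum_(k | k != j) P i k * M k j.

Lemma stationary_ker : p^T *m (1%:M - P) = 0.
Proof. by rewrite mulmxBr mulmx1 hp.1 subrr. Qed.

Lemma stochastic_ker : (1%:M - P) *m e = 0.
Proof. by rewrite mulmxBl mul1mx stP.2 subrr. Qed.

Lemma harmonic_const (x : 'cV[R]_m) : (1%:M - P) *m x = 0 -> exists c, x = c *: e.
Proof.
rewrite mulmxBl mul1mx => /subr0_eq xP.
by apply: (subharmonic_const stP irrP) => i; rewrite -xP.
Qed.

(** Completing the sum over [k != j] to a full product with [P] and pairing with [p], the terms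
    [p^T c] cancel by stationarity. *)
Lemma mean_return_time j : p j 0 * M j j = lambda.
Proof.
pose c := col j M.
have Mc : c = mu + P *m c - M j j *: col j P.
  apply/matrixP => i k; rewrite ord1 !mxE hM -addrA; congr (_ + _).
  rewrite [X in X - _](bigD1 j)//= mxE mulrC addrAC subrr add0r.
  by apply: eq_bigr => l _; rewrite mxE.
have := congr1 (fun x => (p^T *m x) 0 0) Mc.
rewrite mulmxBr mulmxDr -scalemxAr mulmxA hp.1 colE mulmxA hp.1 -colE.
rewrite [in RHS]mxE [X in _ = X + _]mxE [X in _ = _ + X]mxE [X in _ = _ - X]mxE.
rewrite [col j p^T _ _]mxE [p^T 0 j]mxE => /eqP.
rewrite addrAC -subr_eq0 opprD addrCA subrr addr0 oppr_eq0 subr_eq0.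
by move=> /eqP ->; rewrite mulrC.
Qed.

(* W has zero diagonal and W e = k_circ3 M. *)
Let W : 'M[R]_m := \matrix_(i, j) (M i j / M j j - (i == j)%:R).

(** As [W] vanishes on the diagonal, [P W] involves only the sums over [k != j] of the passage
    equations. What remains of those is [mu i / M j j], which is [mu i * p j / lambda] by
    [mean_return_time]. *)
Lemma scaled_passage_eq : (1%:M - P) *m W = lambda^-1 *: (mu *m p^T) - 1%:M.
Proof.
have pM j : (p j 0 != 0) * (M j j != 0).
  have := lt0r_neq0 lambda_gt0; rewrite -(mean_return_time j) mulf_eq0 negb_or.
  by move=> /andP[-> ->].
apply/matrixP => i j; rewrite mulmxBl mul1mx.
transitivity (W i j - \sum_k P i k * W k j).
  by rewrite [LHS]mxE [X in _ + X]mxE [(P *m W) i j]mxE.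
transitivity (lambda^-1 * (mu i 0 * p j 0) - (i == j)%:R); last first.
  rewrite [RHS]mxE [X in _ = X + _]mxE [X in _ = _ + X]mxE [1%:M i j]mxE.
  by rewrite [(mu *m p^T) i j]mxE big_ord1 [p^T 0 j]mxE.
have -> : \sum_k P i k * W k j = (\sum_(k | k != j) P i k * M k j) / M j j.
  rewrite (bigD1 j)//= mxE eqxx divff ?pM// subrr mulr0 add0r mulr_suml.
  by apply: eq_bigr => k kj; rewrite mxE (negbTE kj) subr0 mulrA.
rewrite mxE -(mean_return_time j) invfM addrAC -mulrBl [M i j]hM addrK.
by rewrite [mu i 0 * p j 0]mulrC mulrACA mulVf ?pM// mul1r mulrC.
Qed.

Lemma k_circ3_ginverse (G : 'M[R]_m) : is_ginverse (1%:M - P) G ->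
  k_circ3 M = lambda^-1 *: (G *m mu - \tr (G *m mu *m p^T) *: e)
              - G *m e + \tr G *: e.
Proof.
move=> AGA; set B := lambda^-1 *: (mu *m p^T) - 1%:M.
have pM j : M j j != 0.
  have := lt0r_neq0 lambda_gt0; rewrite -(mean_return_time j) mulf_eq0 negb_or.
  by move=> /andP[].
have [c Wc] : exists c : 'I_m -> R, forall i j, W i j = (G *m B) i j + c j.
  (* [(I - P) G B = (I - P) G (I - P) W = (I - P) W], so each column of [W - G B] is harmonic. *)
  have col_const j : exists c, forall i, W i j = (G *m B) i j + c.
    have [|c cP] := harmonic_const (x := col j (W - G *m B)).
      rewrite colE mulmxA mulmxBr /B -scaled_passage_eq !mulmxA AGA subrr.
      by rewrite mul0mx.
    exists c => i; rewrite -[W i j](subrK ((G *m B) i j)) [RHS]addrC.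
    congr (_ + _); transitivity (col j (W - G *m B) i 0).
      by rewrite 2![RHS]mxE [X in _ = _ + X]mxE.
    by rewrite cP !mxE mulr1.
  by exists (fun j => sval (cid (col_const j))) => i j; case: cid.
(* The zero diagonal of [W] determines the constants. *)
have cE j : c j = - (G *m B) j j.
  have := Wc j j; rewrite {1}/W mxE eqxx divff// subrr => /esym/eqP.
  by rewrite addrC addr_eq0 => /eqP.
have -> : k_circ3 M = W *m e.
  apply/matrixP => i k; rewrite !mxE [RHS](bigD1 i)//=.
  rewrite ![(const_mx _ : 'M[R]__) _ _]mxE mulr1 mxE eqxx divff// subrr add0r.
  by apply: eq_bigr => j ji; rewrite !mxE eq_sym (negbTE ji) subr0 mulr1.
have -> : W *m e = G *m B *m e - \tr (G *m B) *: e.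
  apply/matrixP => i k; rewrite ord1 row_sumE [RHS]mxE row_sumE.
  rewrite [X in _ = _ + X]mxE [X in - X]mxE [X in _ * X]mxE mulr1 /mxtrace -sumrB.
  by apply: eq_bigr => j _; rewrite Wc cE.
have -> : G *m B = lambda^-1 *: (G *m mu *m p^T) - G.
  by rewrite mulmxBr mulmx1 -scalemxAr mulmxA.
rewrite mulmxBl -scalemxAl -[_ *m p^T *m e]mulmxA hp.2 mulmx1 raddfB/= mxtraceZ.
rewrite scalerBr scalerA scalerBl opprB addrA addrAC; congr (_ + _).
exact: addrAC.
Qed.

(** For [x] in the kernel, pairing with [p] removes [I - P] and leaves [b^T x = 0]. Then [x] is
    harmonic, so [x = c e], and [c b^T e = 0] forces [c = 0]. *)
Lemma rank1_perturbation_unitmx (a b : 'cV[R]_m) :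
  (p^T *m a) 0 0 != 0 -> (b^T *m e) 0 0 != 0 -> 1%:M - P + a *m b^T \in unitmx.
Proof.
move=> pa be; apply: unitmx_injective => x; rewrite mulmxDl => xE.
have bx0 : b^T *m x = 0.
  have := congr1 (mulmx p^T) xE.
  rewrite mulmxDr mulmx0 mulmxA stationary_ker mul0mx add0r -mulmxA mulmxA.
  rewrite [p^T *m a]mx11_scalar mul_scalar_mx => /eqP.
  by rewrite scaler_eq0 (negbTE pa)/= => /eqP.
move: xE; rewrite -mulmxA bx0 mulmx0 addr0 => /harmonic_const[c xc].
move: bx0; rewrite xc -scalemxAr => /matrixP/(_ 0 0)/eqP.
rewrite !mxE mulf_eq0 => /orP[/eqP ->|]; first by rewrite scale0r.
by move: be; rewrite mxE => /negbTE ->.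
Qed.

(** The perturbed matrix sends [e] to [(b^T e) a], which gives [Z a]. Then
    [Z (I - P) = I - Z a b^T], and [I - P] kills the column [Z a]. *)
Lemma rank1_perturbation_inv (a b : 'cV[R]_m) (Z : 'M[R]_m) :
  (p^T *m a) 0 0 != 0 -> (b^T *m e) 0 0 != 0 ->
  Z = invmx (1%:M - P + a *m b^T) ->
  Z *m a = ((b^T *m e) 0 0)^-1 *: e /\ is_ginverse (1%:M - P) Z.
Proof.
move=> pa be ZE; have U := rank1_perturbation_unitmx pa be.
have ZA : Z *m (1%:M - P + a *m b^T) = 1%:M by rewrite ZE mulVmx.
have Za : Z *m a = ((b^T *m e) 0 0)^-1 *: e.
  have ze : (b^T *m e) 0 0 *: (Z *m a) = e.
    rewrite scalemxAr -mul_mx_scalar -mx11_scalar [a *m (_ *m _)]mulmxA.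
    rewrite -[a *m _ *m _]add0r.
    by rewrite -stochastic_ker -mulmxDl mulmxA ZA mul1mx.
  by rewrite -[LHS]scale1r -[X in X *: _ = _](mulVf be) -scalerA ze.
split=> //; rewrite /is_ginverse -mulmxA.
have -> : Z *m (1%:M - P) = 1%:M - Z *m a *m b^T.
  by rewrite -[X in _ = X - _]ZA [in RHS]mulmxDr mulmxA addrK.
by rewrite mulmxBr mulmx1 Za mulmxA -scalemxAr stochastic_ker scaler0 mul0mx subr0.
Qed.

End FirstPassageEquations.

(** * Decomposition of measures and integrals over the values of a finite-valued map *)

Section FiberSums.
Context {R : realType} {m : nat} {d : measure_display} {Om : measurableType d}.
Local Open Scope ereal_scope.
Variables (mu : {measure set Om -> \bar R}) (Y : Om -> 'I_m).
Hypothesis mY : forall k, measurable (Y @^-1` [set k]).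

Let fibers (A : set Om) : \big[setU/set0]_(k < m) (A `&` Y @^-1` [set k]) = A.
Proof.
rewrite -bigcup_seq; apply/seteqP; split=> [w [k _ []//]|w Aw].
by exists (Y w) => //=; rewrite mem_index_enum.
Qed.

Let trivIset_fibers (A : set Om) D :
  trivIset D (fun k => A `&` Y @^-1` [set k]).
Proof.
apply/trivIsetP => k l _ _ /eqP kl; apply/seteqP; split=> // w [[_ /= wk] [_ /= wl]].
by apply: kl; rewrite -wk -wl.
Qed.

Lemma measure_fiber_sum (A : set Om) : measurable A ->
  mu A = \sum_(k < m) mu (A `&` Y @^-1` [set k]).
Proof.
move=> mA; rewrite -{1}(fibers A) measure_bigsetU_ord//.
by move=> k; exact: measurableI.
Qed.

Lemma ge0_integral_fiber_sum (A : set Om) (f : Om -> \bar R) : measurable A ->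
  measurable_fun A f -> (forall w, A w -> 0 <= f w) ->
  \int[mu]_(w in A) f w = \sum_(k < m) \int[mu]_(w in A `&` Y @^-1` [set k]) f w.
Proof.
move=> mA mf f0.
rewrite -[in LHS](fibers A) ge0_integral_bigsetU ?index_enum_uniq ?fibers//.
by move=> k; exact: measurableI.
Qed.

End FiberSums.

(** * Integration against a restricted measure *)

Section Restriction.
Context {R : realType} {d : measure_display} {Om : measurableType d}.
Local Open Scope ereal_scope.

(** The complement of [C] is null for the restricted measure, and both measures agree on measurable
    subsets of [C]. *)
Lemma ge0_integral_mrestr (mu : {measure set Om -> \bar R}) (C : set Om)
    (mC : measurable C) (f : Om -> \bar R) :
  measurable_fun setT f -> (forall w, 0 <= f w) ->
  \int[mrestr mu mC]_w f w = \int[mu]_(w in C) f w.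
Proof.
move=> mf f0; have mC' := measurableC mC.
rewrite (@ge0_negligible_integral _ _ _ (mrestr mu mC) _ (~` C))//; last first.
  by rewrite -[RHS](measure0 mu) -(setICl C).
rewrite setTD setCK; apply: eq_measure_integral => A mA AC.
by rewrite /= /mrestr setIidl.
Qed.

End Restriction.


(** * Mean first passage times of a Markov renewal process *)

Section MarkovRenewal.
Context {R : realType} {m : nat} {d : measure_display} {Om : measurableType d}.
Variables (Q : 'I_m -> 'I_m -> cumulative R R).
Variables (X : nat -> Om -> 'I_m) (T : nat -> Om -> R).

(** * Increments of the renewal times under a single law *)

Section OneLaw.
Variable mu : probability Om R.
Hypothesis hmu : is_MRP mu Q X T.

Lemma past_measurable n A : past X T n A -> measurable A.
Proof.
apply: smallest_sub; first exact: sigma_algebra_measurable.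
move=> _ [r _ [[k ->]|[B mB ->]]]; first exact: (mrp_measurableX hmu).
by rewrite -[_ @^-1` _]setTI; exact: (mrp_measurableT hmu).
Qed.

Lemma measurable_increment n :
  measurable_fun [set: Om] (fun w => T n.+1 w - T n w).
Proof. by apply: measurable_funB; exact: (mrp_measurableT hmu). Qed.

Lemma measurable_increment_le n t : measurable [set w | T n.+1 w - T n w <= t].
Proof.
have := measurable_increment n measurableT (measurable_itv `]-oo, t]%R).
by rewrite setTI; congr measurable; apply/seteqP; split=> w /=; rewrite in_itv.
Qed.

Definition transition_event A n i j : set Om :=
  A `&` X n @^-1` [set i] `&` X n.+1 @^-1` [set j].

Lemma measurable_past_state A n i :
  past X T n A -> measurable (A `&` X n @^-1` [set i]).
Proof.
by move=> /past_measurable mA; apply: measurableI => //; exact: (mrp_measurableX hmu).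
Qed.

Lemma measurable_transition_event A n i j :
  past X T n A -> measurable (transition_event A n i j).
Proof.
move=> pA; apply: measurableI; last exact: (mrp_measurableX hmu).
exact: measurable_past_state.
Qed.

(** The Markov property at [b] minus the same at [a]. Half-open intervals are the generators on
    which Lebesgue-Stieltjes measures are compared in [mean_increment]. *)
Lemma increment_law n A i j (a b : R) : a <= b -> past X T n A ->
  (mu (transition_event A n i j `&` [set w | (a < T n.+1 w - T n w <= b)%R])
   = mu (A `&` X n @^-1` [set i]) * (Q i j b - Q i j a)%:E)%E.
Proof.
move=> ab pA.
pose E (t : R) := transition_event A n i j `&` [set w | T n.+1 w - T n w <= t].
have mE (t : R) : measurable (E t).
  apply: measurableI; last exact: measurable_increment_le.
  exact: measurable_transition_event.
have muE (t : R) : mu (E t) = (mu (A `&` X n @^-1` [set i]) * (Q i j t)%:E)%E.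
  rewrite -(mrp_markov hmu _ _ _ pA); congr (mu _).
  by rewrite /E /transition_event -setIA.
have -> : transition_event A n i j `&` [set w | (a < T n.+1 w - T n w <= b)%R]
          = E b `\` E a.
  apply/seteqP; split=> w.
    by move=> [tw /= /andP[aw wb]]; split=> // -[_ /=]; rewrite leNgt aw.
  move=> [[tw /= wb] nE]; split=> //=; rewrite wb andbT ltNge.
  by apply/negP => wa; apply: nE.
have Eab : E a `<=` E b by move=> w [tw /= wa]; split=> //=; exact: le_trans ab.
transitivity (mu (E b) - mu (E a))%E.
  rewrite measureD// ?(setIidr Eab)//.
  by rewrite ltey_eq fin_num_measure.
rewrite !muE EFinB muleBr// fin_num_measure//.
exact: measurable_past_state.
Qed.

(* The law of T_{n+1} - T_n on the transition event is a multiple of the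
   Lebesgue-Stieltjes measure of Q i j, by agreement on half-open intervals. *)
Lemma mean_increment n A i j : past X T n A ->
  (\int[mu]_(w in transition_event A n i j) (T n.+1 w - T n w)%:E
   = mu (A `&` X n @^-1` [set i]) * kernel_mean Q i j)%E.
Proof.
move=> pA; set C := transition_event A n i j.
have mC : measurable C by exact: measurable_transition_event.
have mAi := measurable_past_state i pA.
pose D w := T n.+1 w - T n w.
have mD : measurable_fun [set: Om] (D : Om -> measurableTypeR R).
  exact: measurable_increment.
have D0 w : 0 <= D w by rewrite subr_ge0; exact: (mrp_T_nondecreasing hmu).
pose c := mu (A `&` X n @^-1` [set i]).
have c_ge0 : 0 <= fine c by apply: fine_ge0; rewrite measure_ge0.
pose RR := measurableTypeR R.
(* Passing through an existential keeps [nu] abstract, so that it unfolds only through [nuE]. *)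
have [nu nuE] : exists nu : {measure set RR -> \bar R},
    pushforward (mrestr mu mC) (D : Om -> RR) = nu.
  by unshelve eexists (pushforward (mrestr mu mC) (D : Om -> RR)
                       : {measure set RR -> \bar R}).
have nuQ (B : set RR) : measurable B ->
    nu B = mscale (NngNum c_ge0) (lebesgue_stieltjes_measure (Q i j)) B.
  pose ls : {measure set RR -> \bar R} :=
    mscale (NngNum c_ge0) (lebesgue_stieltjes_measure (Q i j)).
  (* The intervals []-k, k]] exhaust the line and have finite measure, as uniqueness requires. *)
  apply: (@measure_unique _ R RR (@ocitv R) (fun k => `]- k%:R, k%:R]%classic)
    _ _ _ _ nu ls) => //.
  - exact: ocitvI.
  - by move=> k; exact: is_ocitv.
  - exact: bigcup_itvT.
  - move=> _ [[a b] _ <-] /=; have [ab|ba] := leP a b; last first.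
      by rewrite set_itv_ge ?measure0// -leNgt; exact: ltW.
    rewrite /ls /mscale/= /lebesgue_stieltjes_measure /measure_extension.
    rewrite measurable_mu_extE/=; last exact: is_ocitv.
    rewrite wlength_itv_bnd// fineK ?fin_num_measure//.
    rewrite -nuE /pushforward /mrestr setIC -(increment_law i j ab pA).
    by congr (mu (_ `&` _)); apply/seteqP; split=> w /=; rewrite in_itv.
  - move=> k; rewrite -nuE /pushforward /mrestr ltey_eq fin_num_measure//.
    apply: measurableI => //; rewrite -[X in measurable X]setTI.
    by apply: mD => //; apply: measurable_itv.
(* [kernel_mean] integrates over this half-line; since [D >= 0], its preimage under [D] is the whole
   space and no mass is lost. *)
pose I := `[0, +oo[%classic : set (measurableTypeR R).
have mI : measurable I by exact: measurable_itv.
have mf : measurable_fun I (EFin : measurableTypeR R -> \bar R).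
  exact: measurable_funTS.
transitivity (\int[nu]_(t in I) t%:E)%E.
  rewrite -nuE ge0_integral_pushforward//; last first.
    by move=> t; rewrite inE /I/= in_itv/= andbT lee_fin.
  have -> : D @^-1` I = setT.
    by apply/seteqP; split=> // w _; rewrite /I/= in_itv/= D0.
  rewrite ge0_integral_mrestr//.
  exact/measurable_EFinP.
rewrite (eq_measure_integral _ (fun B mB _ => nuQ B mB)) ge0_integral_mscale//.
- by rewrite /= fineK// fin_num_measure.
- by move=> t; rewrite /I/= in_itv/= andbT lee_fin.
Qed.
End OneLaw.

(** * Events of the past, and avoidance of a state *)

Lemma past_setT n : past X T n setT.
Proof. exact: (@measurableT _ (g_sigma_algebraType _)). Qed.

Arguments past_setT : clear implicits.

Lemma pastS n A : past X T n A -> past X T n.+1 A.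
Proof.
apply: sub_sigma_algebra2 => B [r rn Br]; exists r => //.
exact: leqW.
Qed.

Lemma pastI n A B : past X T n A -> past X T n B -> past X T n (A `&` B).
Proof. exact: (@measurableI _ (g_sigma_algebraType _)). Qed.

Lemma pastC n A : past X T n A -> past X T n (~` A).
Proof. exact: (@measurableC _ (g_sigma_algebraType _)). Qed.

Lemma past_state n k : past X T n (X n @^-1` [set k]).
Proof. by apply: sub_sigma_algebra; exists n => //; left; exists k. Qed.

(** Time 0 is exempt, as in the first passage time, so that a start in [j] leads to the return
    time. *)
Fixpoint avoid (j : 'I_m) (n : nat) : set Om :=
  if n is n'.+1 then avoid j n' `&` ~` (X n @^-1` [set j]) else setT.

Lemma avoidP j n w : avoid j n w <-> forall r, (0 < r <= n)%N -> X r w != j.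
Proof.
elim: n => [|n IH] /=.
  by split=> // _ [|r]; rewrite ?ltnn// => /andP[].
split=> [[/IH an /eqP nj] r /andP[r0]|an].
  by rewrite leq_eqVlt => /predU1P[->//|rn]; apply: an; rewrite r0.
split; first by apply/IH => r /andP[r0 rn]; apply: an; rewrite r0 leqW.
by apply/eqP; apply: an; rewrite ltn0Sn leqnn.
Qed.

Lemma past_avoid j n : past X T n (avoid j n).
Proof.
elim: n => [|n IH]; first exact: past_setT.
by apply: pastI; [exact: pastS|apply: pastC; exact: past_state].
Qed.

Arguments past_avoid : clear implicits.

(** * Transition and taboo probabilities under the laws given the initial state *)

Section InitialLaws.
Variable Pr : 'I_m -> probability Om R.
Hypothesis hMRP : forall i, is_MRP (Pr i) Q X T.
Hypothesis hinit : forall i, Pr i [set w | X 0%N w = i] = 1%E.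
Local Notation P := (transition_matrix Q).

Lemma initial_law i k : Pr i (X 0%N @^-1` [set k]) = ((i == k)%:R)%:E.
Proof.
have [<-|ik] := eqVneq; first exact: hinit.
have mX := mrp_measurableX (hMRP i) 0.
have Ci : Pr i (~` (X 0%N @^-1` [set i])) = 0%E.
  by rewrite probability_setC// hinit subee.
apply: (@subset_measure0 _ _ _ (Pr i) _ (~` (X 0%N @^-1` [set i]))) => //.
- exact: measurableC.
- by move=> w /= wk wi; move: ik; rewrite -wk wi eqxx.
Qed.

(** Under [Pr i] the event [X 0 = i] is almost sure, so the Markov property at step 0 shows that
    [Q i j t] is itself a probability. *)
Lemma kernel_bounds i j t : 0 <= Q i j t <= 1.
Proof.
have := mrp_markov (hMRP i) i j t (past_setT 0).
rewrite !setTI hinit mul1e => QE.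
rewrite -!lee_fin -QE measure_ge0 probability_le1//.
apply: measurableI; first exact: (mrp_measurableX (hMRP i)).
apply: (@measurableI _ _ (X 1%N @^-1` [set j]) [set w | T 1%N w - T 0%N w <= t]).
- exact: (mrp_measurableX (hMRP i)).
- exact: (measurable_increment_le (hMRP i)).
Qed.

(** By monotonicity and boundedness, the [lim] in [transition_matrix] is a genuine limit and not a
    default value. *)
Lemma kernel_cvg i j : Q i j t @[t --> +oo] --> P i j.
Proof.
have cQ := @nondecreasing_cvgr _ (Q i j).
rewrite mxE; apply: cvgP; apply: cQ; first exact: cumulative_is_nondecreasing.
by exists 1 => _ [t _ <-]; have /andP[] := kernel_bounds i j t.
Qed.

(** The Markov property with [t] tending to infinity along the integers: the events [F t] increase
    to the transition event. *)
Lemma transition_law k n A i j : past X T n A ->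
  (Pr k (transition_event A n i j)
   = Pr k (A `&` X n @^-1` [set i]) * (P i j)%:E)%E.
Proof.
move=> pA.
pose F (t : nat) := A `&` X n @^-1` [set i]
   `&` [set w | X n.+1 w = j /\ T n.+1 w - T n w <= t%:R].
have FE t : F t = transition_event A n i j `&` [set w | T n.+1 w - T n w <= t%:R].
  by rewrite /F /transition_event -[RHS]setIA.
have mF t : measurable (F t).
  rewrite FE; apply: measurableI.
    exact: (measurable_transition_event (hMRP k)).
  exact: (measurable_increment_le (hMRP k)).
have UF : \bigcup_t F t = transition_event A n i j.
  apply/seteqP; split=> [w [t _]|w tw]; first by rewrite FE => -[].
  exists (Num.truncn (T n.+1 w - T n w)).+1 => //; rewrite FE; split=> //=.
  exact/ltW/truncnS_gt.
have ndF : nondecreasing_seq F.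
  move=> s t st; apply/subsetPset; rewrite !FE => w [tw /= sw]; split=> //=.
  by apply: le_trans sw _; rewrite ler_nat.
have c1 : (Pr k \o F) t @[t --> \oo] --> Pr k (transition_event A n i j).
  by rewrite -UF; apply: nondecreasing_cvg_mu => //; exact: bigcup_measurable.
have c2 : (Pr k \o F) t @[t --> \oo] -->
    (Pr k (A `&` X n @^-1` [set i]) * (P i j)%:E)%E.
  have -> : Pr k \o F =
      (fun t : nat => Pr k (A `&` X n @^-1` [set i]) * (Q i j t%:R)%:E)%E.
    by apply/funext => t; exact: (mrp_markov (hMRP k)).
  apply: cvgeZl.
    by rewrite fin_num_measure//; exact: (measurable_past_state (hMRP k)).
  apply: cvg_EFin; first exact: nearW.
  by have := cvg_comp _ _ (@cvgr_idn R) (@kernel_cvg i j); apply.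
exact: (cvg_unique _ c1 c2).
Qed.

Lemma transition_stochastic : stochastic_mx P.
Proof.
split=> [i j|].
  rewrite mxE; apply: limr_ge; first exact: cvgP (@kernel_cvg i j).
  apply: nearW => t.
  by have /andP[] := kernel_bounds i j t.
apply/matrixP => i z; rewrite ord1 row_sumE mxE; apply: EFin_inj.
have mX n := mrp_measurableX (hMRP i) n.
rewrite -(hinit i) (measure_fiber_sum _ (mX 1%N)); last exact: mX.
rewrite -sumEFin; apply: eq_bigr => j _.
have := transition_law i i j (past_setT 0).
rewrite /transition_event !setTI initial_law eqxx mul1e; exact: esym.
Qed.

(** Induction on [n], splitting over the state [l] at time [n]: [avoid j n] lies in the past, so the
    next step contributes [P l k]. For [k = j] the event at a positive time is empty, which matches
    the zero column. *)
Lemma avoid_law j i n k :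
  (Pr i (avoid j n `&` X n @^-1` [set k]) = ((taboo_mx P j ^+ n) i k)%:E)%E.
Proof.
have mX r := mrp_measurableX (hMRP i) r.
elim: n k => [|n IH] k; first by rewrite /= setTI initial_law expr0 mxE.
have [->|kj] := eqVneq k j.
  rewrite (_ : _ `&` _ = set0) ?measure0; last first.
    by apply/seteqP; split=> // w [[_ /= ?]].
  by rewrite exprSr mxE big1// => l _; rewrite mxE eqxx mulr0.
have -> : avoid j n.+1 `&` X n.+1 @^-1` [set k]
          = avoid j n `&` X n.+1 @^-1` [set k].
  apply/seteqP; split=> w [/= aw kw]; split=> //; first by case: aw.
  by split=> //; rewrite kw; exact/eqP.
rewrite (measure_fiber_sum _ (mX n)); last first.
  apply: measurableI; last exact: mX.
  exact: (past_measurable (hMRP i) (past_avoid j n)).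
rewrite exprSr [X in _ = X%:E]mxE -sumEFin; apply: eq_bigr => l _.
rewrite setIAC; apply: etrans (transition_law i l k (past_avoid j n)) _.
by rewrite IH EFinM [taboo_mx _ _ _ _]mxE kj.
Qed.

Hypothesis hfin : forall i j : 'I_m, (kernel_mean Q i j < +oo)%E.

Lemma kernel_mean_ge0 i j : (0 <= kernel_mean Q i j)%E.
Proof. by apply: integral_ge0 => t /=; rewrite in_itv/= andbT lee_fin. Qed.

Lemma mean_sojourn_ge0 i : 0 <= mean_sojourn Q i 0.
Proof. by rewrite mxE sumr_ge0// => k _; rewrite fine_ge0// kernel_mean_ge0. Qed.

(** Split over [X n = k] and [X n.+1 = l] and apply [mean_increment]; here [l] may be [j], since the
    step that enters [j] still counts. Summing over [l] yields the mean sojourn time in [k]. *)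
Lemma mean_avoid_increment j i n :
  (\int[Pr i]_(w in avoid j n) (T n.+1 w - T n w)%:E
   = ((taboo_mx P j ^+ n *m mean_sojourn Q) i 0)%:E)%E.
Proof.
have mX r := mrp_measurableX (hMRP i) r.
have pa := past_avoid j n.
have ma := past_measurable (hMRP i) pa.
have mD : measurable_fun setT (fun w => (T n.+1 w - T n w)%:E).
  exact/measurable_EFinP/(measurable_increment (hMRP i)).
have D0 w : (0 <= (T n.+1 w - T n w)%:E)%E.
  by rewrite lee_fin subr_ge0 (mrp_T_nondecreasing (hMRP i)).
rewrite (ge0_integral_fiber_sum _ (mX n))//; last exact: measurable_funTS.
rewrite mxE -sumEFin; apply: eq_bigr => k _.
rewrite (ge0_integral_fiber_sum _ (mX n.+1))//; last 2 first.
- exact: measurableI.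
- exact: measurable_funTS.
rewrite mxE EFinM -sumEFin ge0_sume_distrr => [|l _]; last first.
  by rewrite lee_fin fine_ge0// kernel_mean_ge0.
apply: eq_bigr => l _; rewrite -/(transition_event _ _ _ _).
rewrite (mean_increment (hMRP i))// avoid_law fineK//.
by rewrite ge0_fin_numE ?kernel_mean_ge0.
Qed.

(** * The passage time as a series of increments *)

Local Notation never j := (\bigcap_n avoid j n).

(** The claim concerns [Om] alone; the state [j] supplies a law from which to read it off. *)
Lemma measurable_avoid j n : measurable (avoid j n).
Proof. exact: (past_measurable (hMRP j) (past_avoid j n)). Qed.

Lemma measurable_never j : measurable (never j).
Proof. by apply: bigcap_measurable => // n _; exact: measurable_avoid j n. Qed.

(** If [N] is the first visit to [j] after time 0, [avoid j n] holds exactly for [n < N], and the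
    sum telescopes to [T N - T 0]. Without a visit the second term is infinite. *)
Lemma first_passage_time_series j w :
  (first_passage_time X T j w =
   \sum_(n <oo) ((fun w => (T n.+1 w - T n w)%:E) \_ (avoid j n)) w
   + ((cst +oo) \_ (never j)) w)%E.
Proof.
have inc0 n : (0 <= ((fun w => (T n.+1 w - T n w)%:E) \_ (avoid j n)) w)%E.
  apply: erestrict_ge0 => {}w _.
  by rewrite lee_fin subr_ge0 (mrp_T_nondecreasing (hMRP j)).
rewrite /first_passage_time; case: pselect => [h|nh]; last first.
  have nw : never j w.
    move=> n _; apply/avoidP => r /andP[r0 _]; apply/negP => rj.
    by apply: nh; exists r; rewrite r0.
  (* The series is nonnegative, hence not [-oo], so adding [+oo] gives [+oo]. *)
  rewrite [in X in (_ + X)%E]patchE mem_set// addey//.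
  by rewrite gt_eqF// (lt_le_trans (ltNyr 0%R))// nneseries_ge0.
case: ex_minnP => N /andP[N0 /eqP XN] Nmin.
have avN n : avoid j n w <-> (n < N)%N.
  split=> [/avoidP an|nN].
    rewrite ltnNge; apply/negP => Nn.
    by have := an N; rewrite N0 Nn XN eqxx => /(_ isT).
  apply/avoidP => r /andP[r0 rn]; apply/negP => rj.
  by have := Nmin r; rewrite r0 rj leqNgt (leq_ltn_trans rn nN) => /(_ isT).
rewrite [in X in (_ + X)%E]patchE memNset ?adde0; last first.
  by move=> /(_ N I)/avN; rewrite ltnn.
rewrite (nneseries_split 0 N)//= add0n.
rewrite [X in (_ + X)%E]eseries0 ?adde0; last first.
  by move=> n Nn _; rewrite patchE memNset// => /avN; rewrite ltnNge Nn.
rewrite (eq_big_nat _ _ (F2 := fun n => (T n.+1 w - T n w)%:E)); last first.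
  by move=> n /andP[_ nN]; rewrite patchE mem_set//; exact/avN.
by rewrite sumEFin telescope_sumr// (mrp_T0 (hMRP j)) subr0.
Qed.

Hypothesis hirr : irreducible_mx P.

(** The probability of [avoid j n] is [(N^n e) i] with [N] the taboo matrix, the general term of a
    convergent series by [taboo_series], so it tends to 0. *)
Lemma never_law i j : Pr i (never j) = 0%E.
Proof.
have stP := transition_stochastic.
pose e : 'cV[R]_m := const_mx 1.
have e_ge0 k : 0 <= e k 0 by rewrite mxE.
have [v _ vcvg] := taboo_series j stP hirr e_ge0.
have avE n : Pr i (avoid j n) = ((taboo_mx P j ^+ n *m e) i 0)%:E.
  rewrite (measure_fiber_sum _ (mrp_measurableX (hMRP i) n)); last first.
    exact: measurable_avoid j n.
  by rewrite row_sumE -sumEFin; apply: eq_bigr => k _; exact: avoid_law.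
apply/eqP; rewrite eq_le measure_ge0 andbT.
have avoid_cvg : Pr i (avoid j n) @[n --> \oo] --> 0%E.
  under eq_fun do rewrite avE.
  apply: cvg_EFin; first exact: nearW.
  exact: cvg_series_cvg_0 (cvgP _ (vcvg i)).
apply: cvge_ge avoid_cvg; apply: nearW => n; apply: le_measure; rewrite ?inE.
- exact: measurable_never.
- exact: measurable_avoid.
- exact: bigcap_inf.
Qed.

(** Integrating the series term by term gives the sum [v] of [N^n mu], where [N] is the taboo matrix
    and [mu] the mean sojourn vector; the claim is then [v = mu + N v]. *)
Lemma mean_first_passage_eq i j :
  mean_first_passage Pr X T i j = mean_sojourn Q i 0
    + \sum_(k | k != j) P i k * mean_first_passage Pr X T k j.
Proof.
have stP := transition_stochastic.
have [v vE vcvg] := taboo_series j stP hirr mean_sojourn_ge0.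
suff ME k : mean_first_passage Pr X T k j = v k 0.
  rewrite ME {1}vE mxE; congr (_ + _).
  rewrite mulmx_taboo [(P *m v) i 0]mxE (bigD1 j)//= addrAC subrr add0r.
  by apply: eq_bigr => l _; rewrite ME.
have D0 n w : (0 <= (T n.+1 w - T n w)%:E)%E.
  by rewrite lee_fin subr_ge0 (mrp_T_nondecreasing (hMRP i)).
have mD n : measurable_fun setT ((fun w => (T n.+1 w - T n w)%:E) \_ (avoid j n)).
  apply/(measurable_restrictT _ (measurable_avoid j n)).
  apply: measurable_funTS; apply/measurable_EFinP.
  exact: (measurable_increment (hMRP i)).
have mN := measurable_never j.
rewrite mxE; under eq_integral do rewrite first_passage_time_series.
rewrite ge0_integralD//; last 4 first.
- by move=> w _; apply: nneseries_ge0 => n _ _; exact: erestrict_ge0.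
- by apply: ge0_emeasurable_sum => // n w _ _; exact: erestrict_ge0.
- by move=> w _; apply: erestrict_ge0 => x _; rewrite leey.
- by apply/(measurable_restrictT _ mN); exact: measurable_cst.
(* An infinite value on a null event integrates to 0, by the convention [+oo * 0 = 0]. *)
have -> : (\int[Pr k]_w ((cst +oo) \_ (never j)) w = 0)%E.
  rewrite -integral_mkcond; transitivity (+oo * Pr k (never j))%E.
    exact: integral_cst.
  by rewrite never_law mule0.
rewrite adde0.
rewrite integral_nneseries//; last by move=> n w _; exact: erestrict_ge0.
pose a n := (taboo_mx P j ^+ n *m mean_sojourn Q) k 0.
rewrite (eq_eseriesr (g := fun n => (a n)%:E)); last first.
  by move=> n _; rewrite -integral_mkcond mean_avoid_increment.
(* The limit is a real number, so [fine] is a mere cast here. *)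
rewrite (_ : limn _ = (v k 0)%:E)//; apply/cvg_lim => //.
apply: cvg_EFin; first by apply: nearW => n; rewrite sumEFin.
by under eq_fun do rewrite /= sumEFin; exact: vcvg.
Qed.

End InitialLaws.
End MarkovRenewal.

(** * The formulas for general g-inverses, [Z], the group inverse and the perturbation by
    [mu u^T] *)

Unset Implicit Arguments.
Set Strict Implicit.
Set Printing Implicit Defensive.

Theorem corollary3p2 (R : realType) (m : nat)
    (d : measure_display) (Om : measurableType d)
    (Pr : 'I_m -> probability Om R)
    (Q : 'I_m -> 'I_m -> cumulative R R)
    (X : nat -> Om -> 'I_m) (T : nat -> Om -> R)
    (hMRP : forall i : 'I_m, is_MRP (Pr i) Q X T)
    (hinit : forall i : 'I_m, Pr i [set w | X 0%N w = i] = 1%E)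
    (hfin : forall i j : 'I_m, (kernel_mean Q i j < +oo)%E)
    (hirr : irreducible_mx (transition_matrix Q))
    (p : 'cV[R]_m)
    (hp : is_stationary (transition_matrix Q) p) :
  let P := transition_matrix Q in
  let mu := mean_sojourn Q in
  let e : 'cV[R]_m := const_mx 1 in
  let Pi := e *m p^T in
  let lambda := (p^T *m mu) 0 0 in
  let k3 := k_circ3 (mean_first_passage Pr X T) in
  0 < lambda ->
  [/\ forall G : 'M[R]_m, is_ginverse (1%:M - P) G ->
        k3 = lambda^-1 *: (G *m mu - \tr (G *m mu *m p^T) *: e)
             - G *m e + \tr G *: e,
      (1%:M - P + Pi) \in unitmx /\
      forall Z : 'M[R]_m, Z = invmx (1%:M - P + Pi) ->
        k3 = lambda^-1 *: (Z *m mu - \tr (Z *m mu *m p^T) *: e)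
             + \tr Z *: e - e,
      forall Ag : 'M[R]_m, is_group_inverse (1%:M - P) Ag ->
        k3 = lambda^-1 *: (Ag *m mu - \tr (Ag *m mu *m p^T) *: e)
             + \tr Ag *: e
    & forall u : 'cV[R]_m, (u^T *m e) 0 0 != 0 ->
        (1%:M - P + mu *m u^T) \in unitmx /\
        forall Gt : 'M[R]_m, Gt = invmx (1%:M - P + mu *m u^T) ->
          k3 = ((\tr Gt)%:M - Gt) *m e].
Proof.
move=> P mu e Pi lambda k3 lambda_gt0.
have stP : stochastic_mx P by exact: transition_stochastic hMRP hinit.
have hM := mean_first_passage_eq hMRP hinit hfin hirr.
have k3E := k_circ3_ginverse stP hirr hp lambda_gt0 hM.
have pe : (p^T *m e) 0 0 = 1 by rewrite hp.2 mxE.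
have pe0 : (p^T *m e) 0 0 != 0 by rewrite pe oner_neq0.
have lambda0 : (p^T *m mu) 0 0 != 0 by rewrite gt_eqF.
split.
- exact: k3E.
- split; first exact: (rank1_perturbation_unitmx stP hirr hp).
  (* With [a = e] and [b = p], [p^T e = 1] gives [Z e = e]. *)
  move=> Z ZE; have [Ze gZ] := rank1_perturbation_inv stP hirr hp pe0 pe0 ZE.
  rewrite /k3 (k3E _ gZ) Ze pe invr1 scale1r.
  by rewrite addrAC.
- move=> Ag [AGA GAG AG]; rewrite /k3 (k3E _ AGA).
  (* [Ag = Ag A Ag = Ag Ag A] with [A = I - P], and [A e = 0]. *)
  have -> : Ag *m e = 0.
    by rewrite -GAG -[Ag *m _ *m Ag]mulmxA AG -!mulmxA (stochastic_ker stP) !mulmx0.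
  by rewrite subr0.
- move=> u ue; split; first exact: (rank1_perturbation_unitmx stP hirr hp).
  (* With [a = mu] and [b = u], [Gt mu] is a multiple of [e]; since the trace of [e p^T] is 1, the
     term in [lambda^-1] cancels. *)
  move=> Gt GtE; have [Ga gG] := rank1_perturbation_inv stP hirr hp lambda0 ue GtE.
  rewrite /k3 (k3E _ gG) Ga -!scalemxAl mxtraceZ mxtrace_mulC hp.2 mxtrace1 mulr1.
  by rewrite subrr scaler0 sub0r addrC mulmxBl mul_scalar_mx.
Qed.
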